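(* Let $F$ be a field of characteristic zero, let $n\ge 2$, and let $A=BT(n-1,1;F)$ with the grading induced by the Di Vincenzo--Vasilovsky $\mathbb{Z}_n$-grading of $M_n(F)$. Let $k\geq n$ and let $m=x_1\cdots x_k$ be a graded monomial. Then $m$ is a graded polynomial identity of $A$ if and only if $m$ is a consequence of a monomial identity of $A$ of total degree $n$.
   Context: All algebras are associative and unitary. $BT(n-1,1;F)$ is the subalgebra of $M_n(F)$ of block-upper-triangular matrices with diagonal blocks of sizes $n-1$ and $1$, i.e. the matrices whose $(n,j)$-entry is $0$ for all $j<n$. The Di Vincenzo--Vasilovsky grading is $M_n(F)=\bigoplus_{t\in\mathbb{Z}_n}M_n^{(t)}$, where $M_n^{(t)}$ is the span of the elementary matrices $e_{ij}$ with $j-i\equiv t\pmod n$. $F\langle X|\mathbb{Z}_n\rangle$ is the free associative $\mathbb{Z}_n$-graded algebra on $X=\bigcup_{g\in\mathbb{Z}_n}X^g$, where the $X^g$ are disjoint countable sets of variables; variables in $X^g$ have degree $g$. A graded monomial $x_1\cdots x_k$ is a monomial in $F\langle X|\mathbb{Z}_n\rangle$ (distinct variables $x_i$, each with its degree $\deg(x_i)\in\mathbb{Z}_n$). A polynomial $f(x_1,\dots,x_t)\in F\langle X|\mathbb{Z}_n\rangle$ is a graded polynomial identity of a $\mathbb{Z}_n$-graded algebra $A$ if $f(a_1,\dots,a_t)=0$ whenever $a_k\in A^{\deg(x_k)}$ for all $k$; a monomial identity is a monomial that is a graded polynomial identity. A $T_{\mathbb{Z}_n}$-ideal is an ideal of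 $F\langle X|\mathbb{Z}_n\rangle$ invariant under all degree-preserving algebra endomorphisms; a polynomial is a consequence of another one if it lies in the $T_{\mathbb{Z}_n}$-ideal generated by it. *)

(* Defs.v *)
From HB Require Import structures.
From mathcomp Require Import all_boot all_order all_algebra.
From mathcomp Require Import finmap.
From mathcomp.multinomials Require Import monalg.

Set Implicit Arguments.
Unset Strict Implicit.
Unset Printing Implicit Defensive.

Import GRing.Theory.
Local Open Scope ring_scope.

(* 'Z_n is the cyclic group of order n only when 1 < n; everything below is
   meant to be used under that hypothesis. *)

(* The variable (g, i) is the i-th element of X^g, and has degree g. *)
Definition gvar (n : nat) := ('Z_n * nat)%type.

(* F<X | Z_n>, as the algebra of the free (noncommutative) monoid on X. *)
Notation freeGAlg F n := {malg F[{fmonom gvar n}]}.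

Section GradedIdentities.
Variables (F : fieldType) (n : nat).

Definition gmonomial (s : seq (gvar n)) : freeGAlg F n := << FMonom s >>.

Definition word_deg (w : {fmonom gvar n}) : 'Z_n := \sum_(x <- w) x.1.

Definition homogeneous (g : 'Z_n) (f : freeGAlg F n) : Prop :=
  forall w, w \in msupp f -> word_deg w = g.

Definition degree_preserving (phi : freeGAlg F n -> freeGAlg F n) : Prop :=
  forall g f, homogeneous g f -> homogeneous g (phi f).

Record T_ideal (I : freeGAlg F n -> Prop) : Prop := {
  T_ideal0 : I 0;
  T_idealD : forall f g, I f -> I g -> I (f + g);
  T_idealMl : forall h f, I f -> I (h * f);
  T_idealMr : forall h f, I f -> I (f * h);
  T_ideal_endo : forall phi : {lrmorphism freeGAlg F n -> freeGAlg F n},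
    degree_preserving phi -> forall f, I f -> I (phi f) }.

(* The T-ideal generated by f is the intersection of those containing f. *)
Definition consequence (g f : freeGAlg F n) : Prop :=
  forall I, T_ideal I -> I f -> I g.

Definition gpoly_eval (a : gvar n -> 'M[F]_n) (f : freeGAlg F n) : 'M[F]_n :=
  \sum_(w <- msupp f) f@_w *: \prod_(x <- w) a x.

(* A graded subalgebra of M_n(F) is given by its homogeneous components A g. *)
Definition graded_identity (A : 'Z_n -> {pred 'M[F]_n})
    (f : freeGAlg F n) : Prop :=
  forall a : gvar n -> 'M[F]_n,
    (forall x, a x \in A x.1) -> gpoly_eval a f = 0.

Definition DV_component (t : 'Z_n) : {vspace 'M[F]_n} :=
  (\sum_(i < n) \sum_(j < n | (j == i + t %[mod n])%N) <[delta_mx i j]>)%VS.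

(* Row indices start at 0, so the last row is the one of index n.-1. *)
Definition BT : {pred 'M[F]_n} :=
  [pred M : 'M[F]_n | [forall i : 'I_n, forall j : 'I_n,
     (i == n.-1 :> nat) && (j < n.-1)%N ==> (M i j == 0)]].

Lemma BT_subalg : [/\ 1 \in BT, linear_closed BT & GRing.mulr_2closed BT].
Proof.
have BTP (M : 'M[F]_n) : reflect
    (forall i j : 'I_n, i = n.-1 :> nat -> (j < n.-1)%N -> M i j = 0) (M \in BT).
  apply: (iffP forallP) => [H i j /eqP i_n j_n | H i].
    by have /forallP/(_ j) := H i; rewrite i_n j_n => /eqP.
  by apply/forallP => j; apply/implyP => /andP[/eqP i_n j_n]; rewrite H.
split=> [|a u v /BTP Hu /BTP Hv | u v /BTP Hu /BTP Hv]; apply/BTP => i j i_n j_n.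
- by rewrite mxE -val_eqE /= i_n gtn_eqF.
- by rewrite !mxE Hu // Hv // mulr0 addr0.
rewrite mxE big1 // => l _.
case: (ltnP l n.-1) => [l_n | n_l]; first by rewrite Hu // mul0r.
rewrite Hv ?mulr0 //; apply/eqP; rewrite eqn_leq n_l andbT.
by rewrite -ltnS prednK // (leq_ltn_trans _ (ltn_ord l)).
Qed.

Definition BT_component (t : 'Z_n) : {pred 'M[F]_n} :=
  [predI BT & DV_component t].

End GradedIdentities.

(* Main.v *)
Require Import Defs.
From HB Require Import structures.
From mathcomp Require Import all_boot all_order all_algebra.
From mathcomp Require Import finmap.
From mathcomp.multinomials Require Import monalg.

Set Implicit Arguments.
Unset Strict Implicit.
Unset Printing Implicit Defensive.

Import GRing.Theory.
Local Open Scope ring_scope.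

(** Rows and columns are numbered by Z_n, so that a matrix of degree t sends
the row i to the column i + t only, and the entry (i, j) of a product of
homogeneous matrices follows one path i, i + g_1, i + g_1 + g_2, ... given by
the degrees g_1, g_2, ... of its factors. In BT(n-1,1) the one obstruction is
the last row, which has a nonzero entry on the diagonal only: a path dies
exactly when it leaves the last index by a nonzero step. Translating the
starting row i, the path started at 0 has to leave -1 - i. Hence a monomial is
an identity if and only if the path of its degrees, started at 0, leaves every
element of Z_n by a nonzero step at some time ([monomial_identityP]); the list
of the elements so left is called [departures].

Suppose that the path of m leaves every element. Cut m at the times when a new
element is reached for the first time. The n blocks that start at the n first
visits have nonzero degrees, except perhaps the last one. But the last element
is also left at some time, and never before its first visit, so the last
block has a prefix of nonzero degree, and what follows this prefix is set
apart ([first_visit_blocks], [covering_blocks]). The path of the degrees of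
these n blocks leaves every element again, so n variables with these degrees
form a monomial identity of degree n. Sending its variables to the blocks, and
multiplying by what was set apart, gives m ([block_consequence]).

Conversely the graded identities of the algebra form a T-ideal
([graded_identities_T_ideal]), because evaluation is an algebra morphism and
sends homogeneous polynomials to homogeneous matrices. *)

(** * Paths in an abelian group *)

Section Departures.
Variable V : zmodType.
Implicit Types (c d : V) (ds : seq V).

(** Steps equal to zero do not leave the current point, so they do not count:
this is what makes the diagonal entry in the last row harmless. *)
Fixpoint departures c ds : seq V :=
  if ds is d :: ds' then
    let D := departures (c + d) ds' in if d == 0 then D else c :: D
  else [::].

Lemma departures_rcons c ds d :
  departures c (rcons ds d) =
  if d == 0 then departures c ds
  else rcons (departures c ds) (c + \sum_(e <- ds) e).
Proof.
elim: ds c => [|e ds IH] c /=; first by rewrite big_nil addr0.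
by rewrite IH big_cons addrA; case: (d == 0); case: (e == 0).
Qed.

Lemma departures_translate c ds :
  departures c ds = [seq c + v | v <- departures 0 ds].
Proof.
rewrite -[in LHS](addr0 c); elim: ds 0 c => //= d ds IH b c.
by rewrite -addrA IH; case: (d == 0).
Qed.

End Departures.

(** * Cutting a word at the first visits *)

Section Blocks.
Variables (V : finZmodType) (T : Type) (deg : T -> V).
Implicit Types (s b : seq T) (B : seq (seq T)).

Let wdeg s := \sum_(x <- s) deg x.

Let wdeg_cat s1 s2 : wdeg (s1 ++ s2) = wdeg s1 + wdeg s2.
Proof. exact: big_cat. Qed.

Let wdeg_flatten B : \sum_(d <- map wdeg B) d = wdeg (flatten B).
Proof. by rewrite big_map /wdeg big_flatten. Qed.

Let wdeg_rcons s x : wdeg (rcons s x) = wdeg s + deg x.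
Proof. by rewrite -cats1 wdeg_cat /wdeg big_seq1. Qed.

(** Induction on the letters of s. The blocks in B end when the path reaches a
new point, and b is the current, unfinished block. All block degrees in B are
nonzero, as the size condition says, so that V0 lists the visited points in
the order of their first visits; its last element is the start of b. The last
clause holds because that point can only be left within b: it has been left
as soon as some prefix of b has nonzero degree. *)
Lemma first_visit_blocks s :
  exists B b, let V0 := rcons (departures 0 (map wdeg B)) (wdeg (flatten B)) in
  [/\ s = flatten B ++ b /\ size V0 = (size B).+1, uniq V0,
      {subset departures 0 (map deg s) <= V0}, wdeg s \in V0
    & (wdeg (flatten B) \notin departures 0 (map deg s)) \/
      (exists b1 b2, b = b1 ++ b2 /\ wdeg b1 != 0)].
Proof.
elim/last_ind: s => [|s x [B [b [[s_def sizeV] uV sV cV vV]]]].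
  exists [::], [::]; split=> //=; first by rewrite /wdeg mem_seq1.
  by left.
set v := wdeg (flatten B) in sizeV uV sV cV vV *.
set V0 := rcons _ _ in sizeV uV sV cV.
have sum_s : 0 + \sum_(e <- map deg s) e = wdeg s by rewrite add0r big_map.
have sV' : {subset departures 0 (map deg (rcons s x)) <= V0}.
  rewrite map_rcons departures_rcons sum_s; case: eqP => // _ u.
  by rewrite mem_rcons inE => /predU1P[->|/sV].
have [cxV|cxV] := boolP (wdeg (rcons s x) \in V0).
  (* The letter x leads to a visited point, so it extends the current block. *)
  exists B, (rcons b x); split=> //; first by rewrite s_def rcons_cat.
  case: vV => [v_stay|[b1 [b2 [-> b1_neq0]]]]; last first.
    by right; exists b1, (rcons b2 x); rewrite rcons_cat.
  have [cx_v|cx_neqv] := eqVneq (wdeg (rcons s x)) v; last first.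
    right; exists (rcons b x), [::]; rewrite cats0; split=> //.
    apply: contraNneq cx_neqv => bx0.
    by rewrite s_def rcons_cat wdeg_cat bx0 addr0.
  left; rewrite map_rcons departures_rcons sum_s; case: eqP => // /eqP dx.
  rewrite mem_rcons inE (negPf v_stay) orbF -/v -cx_v wdeg_rcons.
  by rewrite -subr_eq0 addrC addKr.
(* The letter x leads to a new point: it completes the current block. *)
exists (rcons B (rcons b x)), [::].
have cx : wdeg (flatten (rcons B (rcons b x))) = wdeg (rcons s x).
  by rewrite flatten_rcons s_def rcons_cat.
have bx_neq0 : wdeg (rcons b x) != 0.
  apply: contraNneq cxV => bx0; rewrite s_def rcons_cat wdeg_cat bx0 addr0.
  by rewrite mem_rcons mem_head.
have -> : departures 0 (map wdeg (rcons B (rcons b x))) = V0.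
  by rewrite map_rcons departures_rcons (negPf bx_neq0) wdeg_flatten add0r.
rewrite /= cx; split.
- rewrite flatten_rcons cats0 s_def rcons_cat (size_rcons V0) sizeV.
  by rewrite size_rcons.
- by rewrite rcons_uniq cxV.
- by move=> u /sV'; rewrite [in X in _ -> X]mem_rcons inE orbC => ->.
- by rewrite mem_rcons mem_head.
- by left; apply: contra cxV => /sV'.
Qed.

(** The last of the first visits gives a block whose degree may be zero. Since
its starting point is left too, it can be shortened to a prefix of nonzero
degree, and then the starting points of the #|V| blocks are all departures. *)
Lemma covering_blocks s :
  (forall v, v \in departures 0 (map deg s)) ->
  exists B b, [/\ s = flatten B ++ b, size B = #|V|
    & forall v, v \in departures 0 [seq \sum_(x <- c) deg x | c <- B]].
Proof.
move=> s_all; have [B [b [[s_def sizeV] uV sV _ vV]]] := first_visit_blocks s.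
case: vV => [|[b1 [b2 [b_def b1_neq0]]]]; first by rewrite s_all.
exists (rcons B b1), b2; rewrite s_def b_def flatten_rcons catA.
rewrite map_rcons departures_rcons.
rewrite -[\sum_(x <- b1) _]/(wdeg b1) (negPf b1_neq0) wdeg_flatten add0r.
rewrite size_rcons -sizeV -(card_uniqP uV).
split=> //; last by move=> v; apply: sV.
by apply: eq_card => v; rewrite sV.
Qed.

End Blocks.

(** * Evaluation on the free algebra *)

Lemma malg_scalerAr (K : monomType) (R : comNzRingType) (c : R)
    (f g : {malg R[K]}) :
  c *: (f * g) = f * (c *: g).
Proof.
rewrite malgME (malgMEw (fsubset_refl _) (msuppZ_le c g)) scaler_sumr.
apply: eq_bigr => k1 _; rewrite scaler_sumr; apply: eq_bigr => k2 _.
apply/malgP=> k.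
rewrite mcoeffZ mcoeffU mcoeffZ mulrCA -mulrnAr; congr (_ * _).
exact: mcoeffU.
Qed.

Section FreeEvaluation.

Variables (F : fieldType) (I : choiceType).

Section Eval.
Variables (S : lalgType F) (a : I -> S).

Definition word_eval (w : {fmonom I}) : S := \prod_(x <- w) a x.

Lemma word_eval_mmorphism : mmorphism word_eval.
Proof.
split=> [w1 w2|]; rewrite /word_eval.
  by rewrite fmM big_cat.
by rewrite fm1 big_nil.
Qed.

HB.instance Definition _ :=
  monalg.isMultiplicative.Build {fmonom I} S word_eval word_eval_mmorphism.

(** Evaluation goes through [mmap], whose additivity and multiplicativity are
generic; [in_alg] turns the scalars into elements of S. *)
Definition free_eval (f : {malg F[{fmonom I}]}) : S :=
  mmap (in_alg S) word_eval f.

Lemma free_evalE f :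
  free_eval f = \sum_(w <- msupp f) f@_w *: \prod_(x <- w) a x.
Proof. by apply: eq_bigr => w _; rewrite mulr_algl. Qed.

Lemma free_eval_linear : linear free_eval.
Proof. by move=> c f g; rewrite /free_eval mmapD mmapZ mulr_algl. Qed.

(** Scalars have to commute with the values of the variables. This is a
hypothesis on a left algebra S, rather than an algebra structure, so that S
can also be the free algebra, the target of a substitution. *)
Lemma free_eval_multiplicative :
  (forall c (x y : S), c *: (x * y) = x * (c *: y)) -> multiplicative free_eval.
Proof.
move=> scalerAr; apply: commr_mmap_is_multiplicative => g w w'.
by rewrite /GRing.comm mulr_algl -scalerAr mulr1.
Qed.

HB.instance Definition _ :=
  GRing.isLinear.Build F {malg F[{fmonom I}]} S _ free_eval free_eval_linear.

Lemma free_eval_word s : free_eval << FMonom s >> = \prod_(x <- s) a x.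
Proof. by rewrite free_evalE msuppU1 big_seq_fset1 mcoeffUU scale1r. Qed.

End Eval.

HB.instance Definition _ (S : algType F) (a : I -> S) :=
  GRing.isMultiplicative.Build {malg F[{fmonom I}]} S (free_eval a)
    (free_eval_multiplicative a (@scalerAr _ S)).

Lemma malg_word s :
  << FMonom s >> = \prod_(x <- s) << FMonom [:: x] >> :> {malg F[{fmonom I}]}.
Proof.
elim: s => [|x s IH].
  by rewrite big_nil; congr << _ >>; apply: val_inj; rewrite /= fm1.
rewrite big_cons -IH malgME !msuppU1 !big_seq_fset1 !mcoeffUU mulr1.
by congr << _ >>; apply: val_inj; rewrite /= fmM.
Qed.

(** The universal property of the free algebra: a morphism is the evaluation at
the images of the variables. *)
Lemma free_eval_unique (S : lalgType F)
    (phi : {lrmorphism {malg F[{fmonom I}]} -> S}) f :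
  phi f = free_eval (fun x => phi << FMonom [:: x] >>) f.
Proof.
rewrite free_evalE {1}[f]monalgE linear_sum; apply: eq_bigr => w _ /=.
have -> : << f@_w *g w >> = f@_w *: << FMonom w >>.
  by apply/malgP => u; rewrite mcoeffZ !mcoeffU fmK mulrnAr mulr1.
by rewrite linearZ malg_word rmorph_prod.
Qed.

End FreeEvaluation.

(** * Monomial identities of BT(n-1,1) *)

Section GradedBT.
Variables (F : fieldType) (n : nat).
(* The size n.+2 makes the indices 'I_N the same type as the group 'Z_N. *)
Local Notation N := n.+2.
Local Notation BTc := (@BT_component F N).
Implicit Types (a : gvar N -> 'M[F]_N) (s : seq (gvar N)).

Let degs s : seq 'Z_N := [seq x.1 | x <- s].

Lemma DV_componentP (t : 'Z_N) (M : 'M[F]_N) :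
  reflect (forall i j : 'Z_N, M i j != 0 -> j = i + t)
          (M \in DV_component F t).
Proof.
have modE (i j : 'Z_N) : ((j : nat) == i + t %[mod N])%N = (j == i + t).
  by rewrite -val_eqE /= [(j %% _)%N]modn_small.
apply: (iffP idP) => [/memv_sumP[vs vsP ->] i j | Mt].
  apply: contraNeq => j_neq; rewrite summxE big1 // => k _.
  have /memv_sumP[us usP ->] := vsP k isT.
  rewrite summxE big1 // => l kl; have /vlineP[c ->] := usP l kl.
  move: kl; rewrite modE => /eqP l_def; rewrite !mxE.
  have [i_k|] := eqVneq i k; last by rewrite mulr0.
  have [j_l|] := eqVneq j l; last by rewrite mulr0.
  by rewrite j_l i_k l_def eqxx in j_neq.
rewrite [M]matrix_sum_delta; apply: rpred_sum => i _; apply: rpred_sum => j _.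
have [->|Mij] := eqVneq (M i j) 0; first by rewrite scale0r mem0v.
apply: memvZ; apply: (subvP (sumv_sup i isT (subvv _))).
apply: (subvP (sumv_sup j _ (subvv _))); last exact: memv_line.
by rewrite modE; apply/eqP/Mt.
Qed.

(** A nonzero entry is an arrow from its row to its column, and an arrow that
starts at the last index is a loop, hence has degree zero. *)
Lemma BT_componentP (t : 'Z_N) (M : 'M[F]_N) :
  reflect (forall i j : 'Z_N, M i j != 0 ->
             j = i + t /\ (i = ord_max -> t = 0))
          (M \in BTc t).
Proof.
rewrite inE; apply: (iffP andP) => [[/forallP BT_M /DV_componentP Mt] i j Mij|H].
  have j_def := Mt i j Mij; split=> // i_max.
  have i_last : (i == N.-1 :> nat) by apply/eqP; rewrite i_max.
  have /forallP/(_ j)/implyP := BT_M i; rewrite i_last /=.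
  move=> /contraNN/(_ Mij); rewrite -leqNgt => j_max.
  have : j = i by apply/val_inj/eqP; rewrite eqn_leq i_max /= j_max -ltnS ltn_ord.
  by rewrite j_def -[RHS]addr0 => /addrI.
split; last by apply/DV_componentP => i j /H[].
apply/forallP => i; apply/forallP => j; apply/implyP => /andP[/eqP i_max].
apply: contraLR => /H[-> t0]; rewrite -leqNgt t0 ?addr0 ?i_max //.
exact: val_inj.
Qed.

(** A nonzero entry of a product comes from a path whose arrows are all nonzero
entries of the factors, so it never leaves the last index. *)
Lemma word_support a s (i j : 'Z_N) :
  (forall x, a x \in BTc x.1) -> (\prod_(x <- s) a x) i j != 0 ->
  j = i + \sum_(d <- degs s) d /\ ord_max \notin departures i (degs s).
Proof.
move=> aP; elim: s i => [|x s IH] i /=.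
  by rewrite !big_nil mxE addr0; case: (i =P j) => // _ /eqP.
rewrite !big_cons mxE => nz.
have [l] : exists l, a x i l * (\prod_(y <- s) a y) l j != 0.
  apply/existsP; apply: contraNT nz; rewrite negb_exists => /forallP nz.
  by rewrite big1 // => l _; apply/eqP; rewrite -[_ == _]negbK.
rewrite mulf_eq0 negb_or => /andP[/(BT_componentP _ _ (aP x))[-> x_max]] /IH[-> D].
rewrite addrA; split=> //; case: ifPn => // x_neq0.
rewrite inE negb_or D andbT; apply: contraNneq x_neq0 => i_max.
by rewrite x_max.
Qed.

(** The sum of all matrix units in the component of degree t. These matrices
decide whether a monomial is an identity: none of their allowed entries
vanishes, so their products keep every path that does not leave the last
index. *)
Definition full_step (t : 'Z_N) : 'M[F]_N :=
  \matrix_(i, j) ((j == i + t) && ((i == ord_max) ==> (t == 0)))%:R.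

Lemma full_step_component t : full_step t \in BTc t.
Proof.
apply/BT_componentP => i j; rewrite mxE.
case: andP => [[/eqP-> /implyP H] _|_]; last by rewrite eqxx.
by split=> // /eqP/H/eqP.
Qed.

Lemma full_step_word s (i : 'Z_N) :
  (\prod_(x <- s) full_step x.1) i (i + \sum_(d <- degs s) d) =
  (ord_max \notin departures i (degs s))%:R.
Proof.
elim: s i => [|x s IH] i /=; first by rewrite !big_nil addr0 mxE eqxx.
rewrite !big_cons mxE (bigD1 (i + x.1)) //= [X in _ + X]big1 ?addr0; last first.
  move=> l l_neq.
  by rewrite mxE (negPf l_neq) mul0r.
rewrite addrA IH mxE eqxx /= -natrM mulnb; congr (_ : bool)%:R.
case: (x.1 == 0); first by rewrite implybT.
by rewrite implybF inE negb_or eq_sym.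
Qed.

Lemma gpoly_eval_word a s : gpoly_eval a (gmonomial F s) = \prod_(x <- s) a x.
Proof. by rewrite /gpoly_eval msuppU1 big_seq_fset1 mcoeffUU scale1r. Qed.

(** By [word_support] and [full_step_word], the monomial is an identity when
every path, whatever its first row i, leaves the last index. Translated by -i
the path starts at 0 and leaves ord_max - i, an arbitrary element of 'Z_N. *)
Lemma monomial_identityP s :
  graded_identity BTc (gmonomial F s) <->
  forall v, v \in departures 0 (degs s).
Proof.
split=> [s_id v|s_all a aP]; last first.
  rewrite gpoly_eval_word; apply/matrixP => i j; rewrite mxE.
  apply/eqP; apply: contraT => /(word_support aP)[_ /negP[]].
  rewrite departures_translate; apply/mapP; exists (ord_max - i) => //.
  by rewrite addrC subrK.
have := s_id (fun x => full_step x.1) (fun x => full_step_component x.1).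
rewrite gpoly_eval_word => /matrixP.
set i : 'Z_N := ord_max - v.
move=> /(_ i (i + \sum_(d <- degs s) d)); rewrite full_step_word mxE.
have [|_ /eqP] := boolP (ord_max \in _); last by rewrite oner_eq0.
rewrite departures_translate => /mapP[u us].
by rewrite -[LHS](subrK v) => /addrI ->.
Qed.
End GradedBT.

(** * Graded identities as a T-ideal *)

Section TIdeal.
Variables (F : fieldType) (n : nat).
Local Notation N := n.+2.
Local Notation BTc := (@BT_component F N).
Local Notation G := (freeGAlg F N).
Implicit Types (t u : 'Z_N) (s : seq (gvar N)).

Lemma BT_component0 t : 0 \in BTc t.
Proof. by apply/BT_componentP => i j; rewrite mxE eqxx. Qed.

Lemma BT_componentD t (A B : 'M[F]_N) :
  A \in BTc t -> B \in BTc t -> A + B \in BTc t.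
Proof.
move=> /BT_componentP At /BT_componentP Bt; apply/BT_componentP => i j.
rewrite mxE; have [->|/At] := eqVneq (A i j) 0; last by [].
by rewrite add0r; apply: Bt.
Qed.

Lemma BT_componentZ t c (A : 'M[F]_N) : A \in BTc t -> c *: A \in BTc t.
Proof.
move=> /BT_componentP At; apply/BT_componentP => i j.
by rewrite mxE mulf_eq0 negb_or => /andP[_ /At].
Qed.

(** If the total degree is nonzero, a path from the last index to elsewhere
would have to leave it; so [word_support] gives both parts of
[BT_componentP]. *)
Lemma BT_component_word (a : gvar N -> 'M[F]_N) (w : {fmonom gvar N}) :
  (forall x, a x \in BTc x.1) -> \prod_(x <- w) a x \in BTc (word_deg w).
Proof.
move=> aP; apply/BT_componentP => i j /(word_support aP)[-> stays].
rewrite big_map; split=> // i_max; rewrite {i}i_max in stays.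
apply/eqP; apply: contraNT stays.
rewrite /word_deg; elim: (w : seq _) => [|x s IH] /=.
  by rewrite big_nil eqxx.
rewrite big_cons; case: (x.1 =P 0) => [->|_ _]; last exact: mem_head.
by rewrite add0r addr0.
Qed.

Lemma gpoly_evalE (a : gvar N -> 'M[F]_N) f : gpoly_eval a f = free_eval a f.
Proof. by rewrite free_evalE. Qed.

Lemma BT_component_eval (a : gvar N -> 'M[F]_N) t (f : G) :
  (forall x, a x \in BTc x.1) -> homogeneous t f -> gpoly_eval a f \in BTc t.
Proof.
move=> aP f_hom; rewrite /gpoly_eval big_seq; elim/big_ind: _ => [|A B|w wf].
- exact: BT_component0.
- exact: BT_componentD.
- by rewrite -(f_hom w wf); apply/BT_componentZ/BT_component_word.
Qed.

Lemma homogeneous0 t : homogeneous t (0 : G).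
Proof. by move=> w; rewrite msupp0 inE. Qed.

Lemma homogeneousD t (f g : G) :
  homogeneous t f -> homogeneous t g -> homogeneous t (f + g).
Proof.
move=> ft gt w /(fsubsetP (msuppD_le f g)).
by rewrite in_fsetU => /orP[/ft|/gt].
Qed.

Lemma homogeneousZ t c (f : G) : homogeneous t f -> homogeneous t (c *: f).
Proof. by move=> ft w /(fsubsetP (msuppZ_le c f))/ft. Qed.

Lemma homogeneous_word s : homogeneous (\sum_(x <- s) x.1) (gmonomial F s).
Proof. by move=> w; rewrite msuppU1 inE => /eqP->. Qed.

(** For an endomorphism phi, evaluating [phi f] at a is evaluating f at the
values of the [phi x] at a, which are admissible because phi preserves
degrees. *)
Lemma graded_identities_T_ideal : T_ideal (graded_identity BTc).
Proof.
split=> [a _|f g f0 g0 a aP|h f f0 a aP|h f f0 a aP|phi phi_deg f f0 a aP].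
- by rewrite gpoly_evalE raddf0.
- by rewrite gpoly_evalE raddfD /= -!gpoly_evalE f0 ?g0 ?addr0.
- by rewrite gpoly_evalE rmorphM /= -!gpoly_evalE f0 ?mulr0.
- by rewrite gpoly_evalE rmorphM /= -!gpoly_evalE f0 ?mul0r.
have -> : gpoly_eval a (phi f) =
    gpoly_eval (fun x => gpoly_eval a (phi (gmonomial F [:: x]))) f.
  rewrite !gpoly_evalE [LHS](free_eval_unique (free_eval a \o phi)) !free_evalE.
  apply: eq_bigr => w _; congr (_ *: _); apply: eq_bigr => x _.
  by rewrite gpoly_evalE.
apply: f0 => x; apply: BT_component_eval => //.
by apply: phi_deg; have := @homogeneous_word [:: x]; rewrite big_seq1.
Qed.

(** * Consequences by substitution of words *)

Definition word_subst (sigma : gvar N -> seq (gvar N)) : G -> G :=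
  free_eval (fun x => gmonomial F (sigma x)).

HB.instance Definition _ sigma := GRing.Linear.on (word_subst sigma).
HB.instance Definition _ sigma :=
  GRing.isMultiplicative.Build G G (word_subst sigma)
    (free_eval_multiplicative _ (@malg_scalerAr _ _)).

Lemma word_subst_word sigma s :
  word_subst sigma (gmonomial F s) = gmonomial F (flatten (map sigma s)).
Proof.
rewrite /word_subst free_eval_word /gmonomial [RHS]malg_word.
by rewrite big_flatten big_map; apply: eq_bigr => x _; rewrite [LHS]malg_word.
Qed.

Lemma word_subst_degree_preserving sigma :
    (forall x, \sum_(y <- sigma x) y.1 = x.1) ->
  degree_preserving (word_subst sigma).
Proof.
move=> sigma_deg t f f_hom; rewrite /word_subst free_evalE big_seq.
elim/big_ind: _ => [|g h|w wf]; first exact: homogeneous0.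
  exact: homogeneousD.
apply: homogeneousZ; rewrite -(f_hom w wf) -free_eval_word.
rewrite -[free_eval _ _]/(word_subst sigma (gmonomial F w)) word_subst_word.
have := @homogeneous_word (flatten (map sigma w)).
by rewrite big_flatten big_map (eq_bigr _ (fun x _ => sigma_deg x)).
Qed.

(** The i-th variable of the shorter monomial has index i and the degree of the
i-th block, so these variables are distinct and sending each to its block
preserves degrees. *)
Lemma block_consequence (B : seq (seq (gvar N))) b :
  consequence (gmonomial F (flatten B ++ b))
    (gmonomial F (mkseq (fun i => (\sum_(x <- nth [::] B i) x.1, i)) (size B))).
Proof.
move=> I I_T I_w.
(* The test makes sigma preserve degrees on all variables; those that do not
   occur in the monomial are left alone when their degree disagrees. *)
pose sigma (x : gvar N) := let c := nth [::] B x.2 in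
  if \sum_(y <- c) y.1 == x.1 then c else [:: x].
have sigma_deg x : \sum_(y <- sigma x) y.1 = x.1.
  by rewrite /sigma; case: eqP => // _; rewrite big_seq1.
have -> : gmonomial F (flatten B ++ b) = gmonomial F (flatten B) * gmonomial F b.
  by rewrite /gmonomial !(malg_word _ (_ ++ _)) big_cat -!malg_word.
apply: (T_idealMr I_T).
have := T_ideal_endo I_T (word_subst_degree_preserving sigma_deg) I_w.
rewrite /= word_subst_word /mkseq -map_comp (eq_map (g := nth [::] B)).
  by rewrite -/(mkseq _ _) mkseq_nth.
by move=> i; rewrite /= /sigma eqxx.
Qed.

End TIdeal.

Theorem proposition18 (F : fieldType) (charF0 : [pchar F] =i pred0)
    (n : nat) (n_ge2 : (2 <= n)%N) (k : nat) (k_ge_n : (n <= k)%N)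
    (m : k.-tuple (gvar n)) (m_uniq : uniq m) :
  graded_identity (@BT_component F n) (gmonomial F m) <->
  exists w : n.-tuple (gvar n),
    graded_identity (@BT_component F n) (gmonomial F w) /\
    consequence (gmonomial F m) (gmonomial F w).
Proof.
case: n n_ge2 m m_uniq {k_ge_n} => [|[|n]] // _ m _.
split=> [/monomial_identityP/covering_blocks[B [b [m_def sizeB B_all]]]|]; last first.
  move=> [w [w_id m_w]]; exact: m_w (@graded_identities_T_ideal F n) w_id.
pose w := mkseq (fun i => (\sum_(x <- nth [::] B i) x.1 : 'Z_n.+2, i)) (size B).
have size_w : size w == n.+2 by rewrite size_mkseq sizeB card_ord.
exists (Tuple size_w); split; last by rewrite m_def; apply: block_consequence.
apply/monomial_identityP => v; have := B_all v.
by rewrite /= -[in X in X -> _](mkseq_nth [::] B) /mkseq -!map_comp.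
Qed.
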